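(* Let $n\ge1$. Let $$V=\Big\{\big(v_1=\begin{pmatrix}a_1\\ b_1\end{pmatrix},\dots,v_n=\begin{pmatrix}a_n\\ b_n\end{pmatrix}\big)\in(\mathbb{R}^2)^n\ \Big|\ a_1b_n\prod_{i=1}^{n-1}(a_ib_{i+1}-a_{i+1}b_i)\neq0\Big\},$$ and let $W$ be the space of nonsingular tridiagonal real symmetric $n\times n$ matrices all of whose superdiagonal entries (the $(i,i+1)$ entries, $1\le i\le n-1$) are nonzero. Let $\mathbb{R}^*=\mathbb{R}\setminus\{0\}$ act on $V$ by letting $r\in\mathbb{R}^*$ send $\begin{pmatrix}a_i\\ b_i\end{pmatrix}$ to $\begin{pmatrix}ra_i\\ r^{-1}b_i\end{pmatrix}$ simultaneously for every $i$. For $(v_1,\dots,v_n)\in V$ let $A$ be the symmetric $n\times n$ matrix whose $(i,j)$ entry is $a_ib_j$ for $i\le j$. Then the map $\widehat{\Psi}\colon V/\mathbb{R}^*\to W$ induced by $\Psi\colon V\to W$, $(v_1,\dots,v_n)\mapsto A^{-1}$, is bijective.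
   Context: For $(v_1,\dots,v_n)\in V$ the matrix $A$ is nonsingular, $A^{-1}$ lies in $W$, and $A$ is unchanged under the $\mathbb{R}^*$-action, so $\Psi$ and $\widehat\Psi$ are well defined. Empty products equal $1$. *)

(* Defs.v *)
From HB Require Import structures.
From mathcomp Require Import all_boot all_order all_algebra.
From mathcomp Require Import generic_quotient.
From mathcomp Require Import boolp classical_sets functions reals.

Set Implicit Arguments.
Unset Strict Implicit.
Unset Printing Implicit Defensive.

Import Order.TTheory GRing.Theory Num.Theory.

Local Open Scope ring_scope.
Local Open Scope classical_set_scope.
Local Open Scope quotient_scope.

(* The size n >= 1 of the matrices is written [n.+1], with indices shifted to
   start from 0. The pairs of consecutive indices (i, i+1) are indexed by
   ['I_n]: they are [(idx i, idx_succ i)]. *)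

Definition idx (n : nat) (i : 'I_n) : 'I_n.+1 := widen_ord (leqnSn n) i.
Definition idx_succ (n : nat) (i : 'I_n) : 'I_n.+1 := lift ord0 i.

Definition vecs (R : realType) (n : nat) := {ffun 'I_n.+1 -> 'cV[R]_2}.

Definition acoord (R : realType) (n : nat) (v : vecs R n) (i : 'I_n.+1) : R :=
  v i 0 0.
Definition bcoord (R : realType) (n : nat) (v : vecs R n) (i : 'I_n.+1) : R :=
  v i 1 0.

Definition inV (R : realType) (n : nat) (v : vecs R n) : bool :=
  acoord v ord0 * bcoord v ord_max *
    \prod_(i < n) (acoord v (idx i) * bcoord v (idx_succ i)
                   - acoord v (idx_succ i) * bcoord v (idx i)) != 0.

Definition V (R : realType) (n : nat) := {v : vecs R n | inV v}.

Definition scale (R : realType) (n : nat) (r : R) (v : vecs R n) : vecs R n :=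
  [ffun i => \col_(k < 2)
     (if k == 0 then r * acoord v i else r^-1 * bcoord v i)].

Lemma acoord_scale (R : realType) (n : nat) (r : R) (v : vecs R n) i :
  acoord (scale r v) i = r * acoord v i.
Proof. by rewrite /acoord ffunE mxE. Qed.

Lemma bcoord_scale (R : realType) (n : nat) (r : R) (v : vecs R n) i :
  bcoord (scale r v) i = r^-1 * bcoord v i.
Proof. by rewrite /bcoord ffunE mxE. Qed.

Lemma vecsP (R : realType) (n : nat) (v w : vecs R n) :
  acoord v =1 acoord w -> bcoord v =1 bcoord w -> v = w.
Proof.
move=> ha hb; apply/ffunP => i; apply/matrixP => k l; rewrite ord1.
case: k => [[|[|//]] hk].
  by have := ha i; rewrite /acoord; congr (v i _ _ = w i _ _); exact: val_inj.
by have := hb i; rewrite /bcoord; congr (v i _ _ = w i _ _); exact: val_inj.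
Qed.

Lemma scale_prod (R : realType) (r x y : R) :
  r != 0 -> r * x * (r^-1 * y) = x * y.
Proof. by move=> r0; rewrite mulrACA mulfV // mul1r. Qed.

Lemma inV_scale (R : realType) (n : nat) (r : R) (v : vecs R n) :
  r != 0 -> inV v -> inV (scale r v).
Proof.
move=> r0; rewrite /inV !acoord_scale !bcoord_scale scale_prod //.
by under [in X in _ -> X]eq_bigr => i _
  do rewrite !acoord_scale !bcoord_scale !scale_prod //.
Qed.

Definition act (R : realType) (n : nat) (r : R) (r0 : r != 0) (v : V R n) :
  V R n := exist _ (scale r (val v)) (inV_scale r0 (valP v)).

Lemma val_act (R : realType) (n : nat) (r : R) (r0 : r != 0) (v : V R n) :
  val (act r0 v) = scale r (val v).
Proof. by []. Qed.

Definition same_orbit (R : realType) (n : nat) (v w : V R n) : bool :=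
  `[< exists (r : R) (r0 : r != 0), w = act r0 v >].

Lemma same_orbit_refl (R : realType) (n : nat) : reflexive (@same_orbit R n).
Proof.
move=> v; apply/asboolP; exists 1, (oner_neq0 R); apply/val_inj/vecsP => i.
  by rewrite val_act acoord_scale mul1r.
by rewrite val_act bcoord_scale invr1 mul1r.
Qed.

Lemma same_orbit_sym (R : realType) (n : nat) : symmetric (@same_orbit R n).
Proof.
suff H v w : @same_orbit R n v w -> same_orbit w v.
  by move=> v w; apply/idP/idP; exact: H.
move=> /asboolP[r [r0 ->]]; apply/asboolP.
have r'0 : r^-1 != 0 by rewrite invr_eq0.
exists r^-1, r'0; apply/val_inj/vecsP => i.
  by rewrite !val_act !acoord_scale mulrA mulVf // mul1r.
by rewrite !val_act !bcoord_scale mulrA mulVf // mul1r.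
Qed.

Lemma same_orbit_trans (R : realType) (n : nat) :
  transitive (@same_orbit R n).
Proof.
move=> w v u /asboolP[r [r0 ->]] /asboolP[s [s0 ->]]; apply/asboolP.
exists (s * r), (mulf_neq0 s0 r0); apply/val_inj/vecsP => i.
  by rewrite !val_act !acoord_scale mulrA.
by rewrite !val_act !bcoord_scale mulrA invfM.
Qed.

Canonical same_orbit_equiv (R : realType) (n : nat) :=
  EquivRel (@same_orbit R n) (@same_orbit_refl R n) (@same_orbit_sym R n)
    (@same_orbit_trans R n).

Definition VmodRstar (R : realType) (n : nat) :=
  {eq_quot @same_orbit R n}.

Definition Amx (R : realType) (n : nat) (v : vecs R n) : 'M[R]_n.+1 :=
  \matrix_(i, j) (if (i <= j)%N then acoord v i * bcoord v j
                  else acoord v j * bcoord v i).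

Definition tridiagonal (R : realType) (n : nat) (M : 'M[R]_n.+1) : Prop :=
  forall i j : 'I_n.+1, (i.+1 < j)%N || (j.+1 < i)%N -> M i j = 0.

Definition W (R : realType) (n : nat) : set 'M[R]_n.+1 :=
  [set M | [/\ M \in unitmx, M^T = M, tridiagonal M
             & forall i : 'I_n, M (idx i) (idx_succ i) != 0]].

(* [invmx M] is the inverse of [M] when [M] is nonsingular, and [M] otherwise;
   since [W] only contains nonsingular matrices, [Psi v] belongs to [W] only if
   [Amx (val v)] is nonsingular. *)
Definition Psi (R : realType) (n : nat) (v : V R n) : 'M[R]_n.+1 :=
  invmx (Amx (val v)).

Definition Psihat (R : realType) (n : nat) (q : VmodRstar R n) : 'M[R]_n.+1 :=
  Psi (repr q).

Lemma Psi_act (R : realType) (n : nat) (r : R) (r0 : r != 0) (v : V R n) :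
  Psi (act r0 v) = Psi v.
Proof.
congr invmx; apply/matrixP => i j; rewrite !mxE val_act.
by rewrite !acoord_scale !bcoord_scale !scale_prod.
Qed.

(* [Psihat] is the map induced by [Psi] on the quotient: it does not depend on
   the representative chosen by [repr]. *)
Lemma Psihat_pi (R : realType) (n : nat) (v : V R n) :
  Psihat (\pi_(VmodRstar R n) v) = Psi v.
Proof.
rewrite /Psihat; case: piP => w /eqmodP /asboolP[r [r0 ->]].
by rewrite Psi_act.
Qed.

(* Main.v *)
(** For a row vector [u], put [P k = \sum_(i < k) u_i a_i] and
    [Q k = \sum_(i >= k) u_i b_i]. Then [(u A)_j = P k b_j + Q k a_j] both for
    [k = j] and for [k = j + 1]. So if [u A] vanishes at [k - 1] and [k], the
    nonvanishing of [a_(k-1) b_k - a_k b_(k-1)] forces [P k = Q k = 0]; applied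
    to [u A = 0] and to the rows [u] of [A^-1], this shows that [A] is
    nonsingular and that [A^-1] lies in [W].
    Conversely, let [M] be in [W] and [B = M^-1]. The [j]-th column of [B] is
    killed by the rows [i < j] of [M], and this three-term recurrence determines
    [B_ij], [i <= j], up to the factor [B_0j]; hence [B_ij = a_i B_0j] with
    [a_i = B_in / B_0n]. *)

Require Import Defs.
From mathcomp Require Import all_boot all_order all_algebra.
From mathcomp Require Import generic_quotient ring.
From mathcomp Require Import boolp classical_sets functions reals.

Set Implicit Arguments.
Unset Strict Implicit.
Unset Printing Implicit Defensive.

Import Order.TTheory GRing.Theory Num.Theory.

Local Open Scope ring_scope.
Local Open Scope classical_set_scope.
Local Open Scope quotient_scope.

Section Amx.
Variables (R : realType) (n : nat).
Implicit Types (v w : vecs R n) (u : 'rV[R]_n.+1) (M : 'M[R]_n.+1).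

(** * Entries of [A] and the conditions defining [V] *)

Lemma AmxE v (i j : 'I_n.+1) :
  (i <= j)%N -> Amx v i j = acoord v i * bcoord v j.
Proof. by move=> ij; rewrite mxE ij. Qed.

Lemma Amx_tr v : (Amx v)^T = Amx v.
Proof.
apply/matrixP => i j; rewrite !mxE; case: (ltngtP i j) => // ij.
by rewrite (val_inj ij).
Qed.

Lemma AmxE_ge v (i j : 'I_n.+1) :
  (j <= i)%N -> Amx v i j = acoord v j * bcoord v i.
Proof. by move=> ji; rewrite -Amx_tr mxE AmxE. Qed.

Lemma inVP v : reflect
  [/\ acoord v ord0 != 0, bcoord v ord_max != 0
    & forall i : 'I_n, acoord v (idx i) * bcoord v (idx_succ i)
                       - acoord v (idx_succ i) * bcoord v (idx i) != 0]
  (inV v).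
Proof.
rewrite /inV !mulf_eq0 !negb_or -andbA.
apply: (iffP and3P) => -[a0 bn H]; split => //.
  by move=> i; move/prodf_neq0 : H => /(_ i isT).
by apply/prodf_neq0 => i _.
Qed.

(** For [i > 0], a zero vector at [i] would kill the determinant of the pair [(i-1, i)]. *)
Lemma inV_neq0 v (i : 'I_n.+1) :
  inV v -> (acoord v i != 0) || (bcoord v i != 0).
Proof.
move=> /inVP[a0 _ D]; case: (unliftP ord0 i) => [j ->|->]; last by rewrite a0.
rewrite -negb_and; apply: contra (D j) => /andP[/eqP aj /eqP bj].
by rewrite /idx_succ aj bj mulr0 mul0r subrr.
Qed.

(** * Row vectors times [A], through the partial sums [P] ([psum]) and [Q] ([qsum]) *)

Definition psum v u (k : nat) : R :=
  \sum_(i < n.+1 | (i < k)%N) u 0 i * acoord v i.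
Definition qsum v u (k : nat) : R :=
  \sum_(i < n.+1 | (k <= i)%N) u 0 i * bcoord v i.

Lemma psumS v u (i : 'I_n.+1) :
  psum v u i.+1 = u 0 i * acoord v i + psum v u i.
Proof.
rewrite /psum (bigD1 i) //=; congr (_ + _).
by apply: eq_bigl => j; rewrite ltnS -val_eqE ltn_neqAle andbC.
Qed.

Lemma qsumS v u (i : 'I_n.+1) :
  qsum v u i = u 0 i * bcoord v i + qsum v u i.+1.
Proof.
rewrite /qsum (bigD1 i) //=; congr (_ + _).
by apply: eq_bigl => j; rewrite -val_eqE (ltn_neqAle i) andbC eq_sym.
Qed.

Lemma mulmx_Amx v u (j : 'I_n.+1) :
  (u *m Amx v) 0 j = psum v u j * bcoord v j + qsum v u j * acoord v j.
Proof.
rewrite mxE (bigID (fun i : 'I_n.+1 => (i < j)%N)) /=; congr (_ + _).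
  rewrite /psum mulr_suml; apply: eq_bigr => i ij.
  by rewrite AmxE 1?ltnW // mulrA.
rewrite /qsum mulr_suml; apply: eq_big => i; first by rewrite -leqNgt.
by rewrite -leqNgt => ji; rewrite AmxE_ge // mulrCA mulrC.
Qed.

Lemma mulmx_AmxS v u (j : 'I_n.+1) :
  (u *m Amx v) 0 j =
  psum v u j.+1 * bcoord v j + qsum v u j.+1 * acoord v j.
Proof. by rewrite mulmx_Amx qsumS psumS; ring. Qed.

Lemma cramer2_eq0 (a b c d x y : R) : a * d - c * b != 0 ->
  x * b + y * a = 0 -> x * d + y * c = 0 -> x = 0 /\ y = 0.
Proof.
move=> D e1 e2; split; apply/(mulfI D); rewrite mulr0.
  have -> : (a * d - c * b) * x = a * (x * d + y * c) - c * (x * b + y * a).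
    by ring.
  by rewrite e1 e2 !mulr0 subrr.
have -> : (a * d - c * b) * y = d * (x * b + y * a) - b * (x * d + y * c).
  by ring.
by rewrite e1 e2 !mulr0 subrr.
Qed.

(** The columns concerned are [k-1] and [k], which give a 2 x 2 linear system in the two sums. At
    the ends only one column exists, but one sum is empty: [a_0 != 0] settles [k = 0], and
    [b_n != 0] settles [k = n.+1]. *)
Lemma psum_qsum_eq0 v u (k : nat) : inV v -> (k <= n.+1)%N ->
  (forall j : 'I_n.+1, (j <= k <= j.+1)%N -> (u *m Amx v) 0 j = 0) ->
  psum v u k = 0 /\ qsum v u k = 0.
Proof.
move=> /inVP[a0 bn D]; case: k => [_ H|k + H].
  have p0 : psum v u 0 = 0 by rewrite /psum big1.
  split=> //; apply/(mulIf a0); rewrite mul0r.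
  by have := H ord0 isT; rewrite mulmx_Amx p0 mul0r add0r.
rewrite ltnS leq_eqVlt => /predU1P[kn|kn].
  rewrite {}kn in H *.
  have q0 : qsum v u n.+1 = 0.
    by rewrite /qsum big1 // => i; rewrite leqNgt ltn_ord.
  split=> //; apply/(mulIf bn); rewrite mul0r.
  have := H ord_max; rewrite /= leqnSn leqnn => /(_ isT).
  by rewrite mulmx_AmxS q0 mul0r addr0.
apply: (cramer2_eq0 (D (Ordinal kn))).
  by have := H (idx (Ordinal kn)); rewrite mulmx_AmxS /= leqnSn leqnn; exact.
have := H (idx_succ (Ordinal kn)).
by rewrite mulmx_Amx /= /bump leq0n add1n leqnSn leqnn; exact.
Qed.

Lemma psum_qsum_entry v u (i : 'I_n.+1) : inV v ->
  psum v u i = psum v u i.+1 -> qsum v u i = qsum v u i.+1 -> u 0 i = 0.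
Proof.
move=> /(inV_neq0 i) ab.
rewrite psumS qsumS => /esym/(canRL (addrK _)) + /(canRL (addrK _)).
rewrite !subrr => /eqP + /eqP; rewrite !mulf_eq0; case: eqP => //= _ a0 b0.
by rewrite a0 b0 in ab.
Qed.

(** Columns [i-1], [i], [i+1] make both sums vanish at the cuts [i] and [i.+1], and the two cuts
    differ by the term of index [i]. This locality is the source of tridiagonality. *)
Lemma Amx_entry_eq0 v u (i : 'I_n.+1) : inV v ->
  (forall j : 'I_n.+1, (i <= j.+1)%N -> (j <= i.+1)%N ->
    (u *m Amx v) 0 j = 0) ->
  u 0 i = 0.
Proof.
move=> vV H.
have [||p q] := @psum_qsum_eq0 v u i vV; first exact: ltnW.
  by move=> j /andP[ji ij]; apply: H => //; rewrite (leq_trans ji).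
have [||p' q'] := @psum_qsum_eq0 v u i.+1 vV; first exact: ltn_ord.
  by move=> j /andP[ji ij]; apply: H => //; rewrite (leq_trans _ ij).
by apply: psum_qsum_entry vV _ _; rewrite (p, q) (p', q').
Qed.

(** * Nonsingularity of [A] and membership of its inverse in [W] *)

Lemma Amx_unitmx v : inV v -> Amx v \in unitmx.
Proof.
move=> vV; rewrite -row_free_unit -kermx_eq0; apply/eqP.
apply/row_matrixP => k; apply/rowP => i; rewrite row0 [RHS]mxE.
apply: (Amx_entry_eq0 vV) => j _ _.
by rewrite -row_mul mulmx_ker row0 mxE.
Qed.

Lemma inv_Amx_W v : inV v -> @W R n (invmx (Amx v)).
Proof.
move=> vV; have Au := Amx_unitmx vV.
have rowA i j : (row i (invmx (Amx v)) *m Amx v) 0 j = (i == j)%:R.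
  by rewrite -row_mul mulVmx // !mxE.
split.
- by rewrite unitmx_inv.
- by rewrite trmx_inv Amx_tr.
- move=> k i ki.
  have -> : invmx (Amx v) k i = row k (invmx (Amx v)) 0 i by rewrite mxE.
  apply: (Amx_entry_eq0 vV) => j ij ji; rewrite rowA; case: eqP => // kj.
  move: ki; rewrite kj => /orP[|].
    by rewrite ltnNge ij.
  by rewrite ltnNge ji.
(* Row [k] of the inverse satisfies [u A = e_k], so its sums vanish at the cut [k.+2]. A zero entry
   at [k+1] carries this down to the cut [k.+1], so [(u A)_k = 0] instead of 1. *)
move=> k; apply/eqP => Mk0.
set u := row (idx k) (invmx (Amx v)).
have uk0 : u 0 (idx_succ k) = 0 by rewrite mxE.
have [||p q] := @psum_qsum_eq0 v u k.+2 vV.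
- by rewrite !ltnS.
- move=> j /andP[_ kj]; rewrite rowA; case: eqP => // jk.
  by move: kj; rewrite -jk ltnn.
have := psumS v u (idx_succ k); have := qsumS v u (idx_succ k).
have -> : idx_succ k = k.+1 :> nat by [].
rewrite p q uk0 !mul0r !add0r => q' /esym p'.
have := rowA (idx k) (idx k).
by rewrite eqxx mulmx_AmxS p' q' !mul0r addr0 => /esym/eqP; rewrite oner_eq0.
Qed.

(** * Surjectivity onto [W] *)

(** In each column, rows [i] and [i+1] of [A] are a common multiple of [(b_i, b_(i+1))] or of
    [(a_i, a_(i+1))]. Hence a linear relation between [v_i] and [v_(i+1)] is one between these
    rows. *)
Lemma Amx_unitmx_det2_neq0 v (i : 'I_n) : Amx v \in unitmx ->
  acoord v (idx i) * bcoord v (idx_succ i)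
  - acoord v (idx_succ i) * bcoord v (idx i) != 0.
Proof.
move=> Au.
have free c d : c * acoord v (idx i) + d * acoord v (idx_succ i) = 0 ->
    c * bcoord v (idx i) + d * bcoord v (idx_succ i) = 0 -> c = 0 /\ d = 0.
  move=> ha hb.
  pose u : 'rV[R]_n.+1 :=
    c *: delta_mx 0 (idx i) + d *: delta_mx 0 (idx_succ i).
  have uA0 : u *m Amx v = 0.
    apply/rowP => j; rewrite mulmxDl -!scalemxAl -!rowE [RHS]mxE.
    transitivity (c * Amx v (idx i) j + d * Amx v (idx_succ i) j).
      by rewrite !mxE.
    case: (leqP j i) => ij.
      rewrite !AmxE_ge //; last by rewrite (leq_trans ij) //= /bump leq0n leqW.
      by rewrite !(mulrCA _ (acoord v j)) -mulrDr hb mulr0.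
    rewrite !AmxE //; last exact: ltnW.
    by rewrite !mulrA -mulrDl ha mul0r.
  have u0 : u = 0 by rewrite -(mulmxK Au u) uA0 mul0mx.
  have ii' : (idx_succ i == idx i) = false.
    by rewrite -val_eqE /= /bump leq0n add1n eqn_leq ltnn.
  split.
    have := congr1 (fun x : 'rV[R]_n.+1 => x 0 (idx i)) u0.
    by rewrite !mxE !eqxx eq_sym ii' mulr1 mulr0 addr0.
  have := congr1 (fun x : 'rV[R]_n.+1 => x 0 (idx_succ i)) u0.
  by rewrite !mxE !eqxx ii' mulr1 mulr0 add0r.
(* If the determinant is 0, its cofactors are coefficients of relations, which forces [v_i = 0];
   then [(1, 0)] is a nontrivial relation. *)
apply/eqP => D0.
have [||_ b0] := free (bcoord v (idx_succ i)) (- bcoord v (idx i)).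
- by rewrite -[RHS]D0; ring.
- by ring.
have [||_ a0] := free (acoord v (idx_succ i)) (- acoord v (idx i)).
- by ring.
- by rewrite -[RHS]oppr0 -D0; ring.
have [||/eqP] := free 1 0; last by rewrite oner_eq0.
- by rewrite mul0r addr0 mul1r -[LHS]opprK a0 oppr0.
- by rewrite mul0r addr0 mul1r -[LHS]opprK b0 oppr0.
Qed.

(** Row [l] of [M z = 0] gives [z_(l+1)] in terms of earlier entries, since [M] has no entry beyond
    the superdiagonal and that one is nonzero. *)
Lemma tridiagonal_col_eq0 M (z : 'cV[R]_n.+1) (j : nat) :
  tridiagonal M -> (forall i : 'I_n, M (idx i) (idx_succ i) != 0) ->
  z ord0 0 = 0 -> (forall i : 'I_n.+1, (i < j)%N -> (M *m z) i 0 = 0) ->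
  forall i : 'I_n.+1, (i <= j)%N -> z i 0 = 0.
Proof.
move=> Mtri Msup z0 Mz i.
move: {2}(i : nat) (leqnn i) => k; elim: k i => [|k IH] i ik ij.
  by rewrite -z0; congr (z _ _); apply: val_inj; apply/eqP; rewrite -leqn0.
case: (unliftP ord0 i) => [l|->]; last exact: z0.
rewrite -[lift _ _]/(idx_succ l) => il.
have li : i = l.+1 :> nat by rewrite il.
apply/(mulfI (Msup l)); rewrite mulr0 -(Mz (idx l)); last by rewrite -li.
rewrite mxE (bigD1 (idx_succ l)) //= -il big1 ?addr0 // => m mi.
have [ml|lm] := leqP m l.
  by rewrite IH ?mulr0 // (leq_trans ml) // -ltnS -li // ltnW.
rewrite Mtri ?mul0r //; apply/orP; left => /=.
by rewrite ltn_neqAle lm andbT -li eq_sym.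
Qed.

Lemma W_inv_Amx M : @W R n M -> exists2 v, inV v & invmx (Amx v) = M.
Proof.
move=> [Mu Msym Mtri Msup]; pose B := invmx M.
have MB i j : (M *m B) i j = (i == j)%:R by rewrite mulmxV // mxE.
have Bsym i j : B i j = B j i.
  by rewrite /B -{1}Msym -trmx_inv mxE.
(* Otherwise the recurrence kills the whole last column of [B], against [(M B)_nn = 1]. *)
have B0n : B ord0 ord_max != 0.
  apply/eqP => B0; suff /eqP : (M *m B) ord_max ord_max = 0.
    by rewrite MB eqxx oner_eq0.
  rewrite mxE big1 // => i _.
  have -> : B i ord_max = col ord_max B i 0 by rewrite mxE.
  rewrite (@tridiagonal_col_eq0 M _ n Mtri Msup) ?mulr0 //.
  - by rewrite mxE.
  - move=> k kn; rewrite colE mulmxA -colE mxE MB; case: eqP => // kE.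
    by rewrite kE ltnn in kn.
  - by rewrite -ltnS.
have Bprop (i j : 'I_n.+1) : (i <= j)%N ->
    B i j = B i ord_max / B ord0 ord_max * B ord0 j.
  (* This combination of columns [j] and [n] vanishes at index 0 and is killed by the rows of [M]
     before [j]. *)
  move=> ij; pose z := B ord0 ord_max *: col j B - B ord0 j *: col ord_max B.
  have : z i 0 = 0.
    apply: (@tridiagonal_col_eq0 M z j Mtri Msup) => //.
      by rewrite !mxE mulrC subrr.
    move=> k kj; rewrite mulmxBr -!scalemxAr !colE !mulmxA -!colE.
    transitivity (B ord0 ord_max * (M *m B) k j
                  - B ord0 j * (M *m B) k ord_max); first by rewrite !mxE.
    rewrite !MB -!val_eqE /= !ltn_eqF ?mulr0 ?subrr //.
    by rewrite (leq_trans kj) // -ltnS.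
  rewrite !mxE => /subr0_eq zE; apply: (mulfI B0n).
  by rewrite zE; field; rewrite B0n.
(* The representative normalized by [a_0 = 1]. *)
pose v : vecs R n := [ffun i => \col_(k < 2)
  if k == 0 then B i ord_max / B ord0 ord_max else B ord0 i].
have av i : acoord v i = B i ord_max / B ord0 ord_max.
  by rewrite /acoord ffunE mxE.
have bv i : bcoord v i = B ord0 i by rewrite /bcoord ffunE mxE.
have vB : Amx v = B.
  apply/matrixP => i j; case: (leqP i j) => [|/ltnW] ij.
    by rewrite AmxE // av bv -Bprop.
  by rewrite AmxE_ge // av bv -Bprop // Bsym.
exists v; last by rewrite vB invmxK.
apply/inVP; split.
- by rewrite av mulfV // oner_eq0.
- by rewrite bv.
by move=> i; apply: Amx_unitmx_det2_neq0; rewrite vB unitmx_inv.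
Qed.

(** * Injectivity modulo scaling, and the conclusion *)

(** Row 0 of [A], with entries [a_0 b_j], determines [b] up to the factor fixed by [a_0]; the last
    column, with entries [a_i b_n], then determines [a]. *)
Lemma Amx_eq_scale v w : inV v -> inV w -> Amx v = Amx w ->
  exists2 r : R, r != 0 & w = scale r v.
Proof.
move=> /inVP[av0 bvn _] /inVP[aw0 _ _] vw.
have AE (i j : 'I_n.+1) : (i <= j)%N ->
    acoord v i * bcoord v j = acoord w i * bcoord w j.
  by move=> ij; rewrite -!AmxE // vw.
pose r := acoord w ord0 / acoord v ord0.
have r0 : r != 0 by rewrite mulf_neq0 // invr_eq0.
have bE j : bcoord w j = r^-1 * bcoord v j.
  by apply: (mulfI aw0); rewrite -AE // /r; field; rewrite av0.
exists r => //; apply: vecsP => i; rewrite ?acoord_scale ?bcoord_scale //.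
have := AE i ord_max; rewrite -ltnS ltn_ord bE => /(_ isT).
rewrite mulrA => /(mulIf bvn) ->.
by rewrite mulrCA mulfV // mulr1.
Qed.

End Amx.

Theorem proposition3p3 (R : realType) (n : nat) :
  set_bij [set: VmodRstar R n] (@W R n) (@Psihat R n).
Proof.
split.
- by move=> q _; exact: inv_Amx_W (valP (repr q)).
- move=> q q' _ _ /(congr1 invmx); rewrite /Psihat /Psi !invmxK => qq'.
  have [r r0 rE] := Amx_eq_scale (valP (repr q)) (valP (repr q')) qq'.
  rewrite -[q]reprK -[q']reprK; apply/eqmodP/asboolP.
  by exists r, r0; apply: val_inj; rewrite rE.
move=> M /W_inv_Amx[v vV vM].
by exists (\pi_(VmodRstar R n) (exist _ v vV)); rewrite // Psihat_pi.
Qed.
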